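(* For all finite sets of formulas $\Gamma,\Delta$ the following are equivalent. (i) $\mathbf{D}^2_{\rm seq}\vdash\Gamma\Rightarrow_{\mathsf D}\Delta$. (ii) $\mathbf{D}^3_{\rm seq}\vdash\Gamma\Rightarrow_{\mathsf D}\Delta$. (iii) $\mathbf{D}_{\rm H}\vdash\bigwedge\Gamma\to\bigvee\Delta$.
   Context: Formulas are built from propositional variables and $\bot$ by $\to$ and $\Box$; other connectives are the usual classical abbreviations; the empty conjunction is $\top$ and the empty disjunction is $\bot$. $\Gamma,\Delta,\Pi,\Sigma,\ldots$ denote finite sets of formulas; commas denote union; $\Box\Gamma=\{\Box\gamma\mid\gamma\in\Gamma\}$. There are three kinds of sequents (tagged pairs of finite sets of formulas): GL-sequents $\Gamma\Rightarrow\Delta$, S-sequents $\Gamma\Rightarrow_{\mathsf S}\Delta$, D-sequents $\Gamma\Rightarrow_{\mathsf D}\Delta$. For each arrow $\blacktriangleright\in\{\Rightarrow,\Rightarrow_{\mathsf S},\Rightarrow_{\mathsf D}\}$, $\mathbf{LK}_{\blacktriangleright}$ has initial sequents $\varphi\blacktriangleright\varphi$ and $\bot\blacktriangleright\ $ (empty right side) and the rules: (weakening) from $\Gamma\blacktriangleright\Delta$ infer $\Gamma'\blacktriangleright\Delta'$, where $\Gamma\subseteq\Gamma'$, $\Delta\subseteq\Delta'$; ($\to$left) from $\Gamma\blacktriangleright\Delta,\varphi$ and $\psi,\Gamma\blacktriangleright\Delta$ infer $\varphi\to\psi,\Gamma\blacktriangleright\Delta$; ($\to$right) from $\varphi,\Gamma\blacktriangleright\Delta,\psi$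 infer $\Gamma\blacktriangleright\Delta,\varphi\to\psi$; (cut) from $\Gamma\blacktriangleright\Delta,\varphi$ and $\varphi,\Pi\blacktriangleright\Sigma$ infer $\Gamma,\Pi\blacktriangleright\Delta,\Sigma$. Further rules: (GL$\Box$) from $\Gamma,\Box\Gamma,\Box\varphi\Rightarrow\varphi$ infer $\Box\Gamma\Rightarrow\Box\varphi$; (GLtoS) from $\Gamma\Rightarrow\Delta$ infer $\Gamma\Rightarrow_{\mathsf S}\Delta$; (S$\Box$left) from $\varphi,\Gamma\Rightarrow_{\mathsf S}\Delta$ infer $\Box\varphi,\Gamma\Rightarrow_{\mathsf S}\Delta$; (GLtoD) from $\Gamma,\Box\Gamma\Rightarrow\Box\Delta$ infer $\Box\Gamma\Rightarrow_{\mathsf D}\Box\Delta$; (StoD) from $\Box\Gamma\Rightarrow_{\mathsf S}\Box\Delta$ infer $\Box\Gamma\Rightarrow_{\mathsf D}\Box\Delta$. $\mathbf{D}^2_{\rm seq}$ consists of $\mathbf{LK}_{\Rightarrow}$, $\mathbf{LK}_{\Rightarrow_{\mathsf D}}$, (GL$\Box$), (GLtoD). $\mathbf{D}^3_{\rm seq}$ consists of $\mathbf{LK}_{\Rightarrow}$, $\mathbf{LK}_{\Rightarrow_{\mathsf S}}$, $\mathbf{LK}_{\Rightarrow_{\mathsf D}}$, (GL$\Box$), (GLtoS), (S$\Box$left), (StoD). Hilbert systems. $\mathbf{GL}_{\rm H}$: axioms are all tautologies, $\Box(\varphi\to\psi)\to(\Box\varphi\to\Box\psi)$, $\Box(\Box\varphi\to\varphi)\to\Box\varphi$;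 rules are modus ponens and necessitation (from $\varphi$ infer $\Box\varphi$). $\mathbf{D}_{\rm H}$: axioms are all theorems of $\mathbf{GL}_{\rm H}$, $\neg\Box\bot$, and all $\Box(\Box\varphi\lor\Box\psi)\to\Box\varphi\lor\Box\psi$; the only rule is modus ponens. *)

(* Defs.v *)
From HB Require Import structures.
From mathcomp Require Import all_boot finmap.

Set Implicit Arguments.
Unset Strict Implicit.
Unset Printing Implicit Defensive.

Local Open Scope fset_scope.

Inductive formula : Type :=
| Var of nat
| Bot
| Imp of formula & formula
| Box of formula.

Fixpoint tree_of_formula (phi : formula) : GenTree.tree nat :=
  match phi with
  | Var n => GenTree.Leaf n
  | Bot => GenTree.Node 0 [::]
  | Imp phi1 phi2 =>
      GenTree.Node 1 [:: tree_of_formula phi1; tree_of_formula phi2]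
  | Box phi1 => GenTree.Node 2 [:: tree_of_formula phi1]
  end.

Fixpoint formula_of_tree (t : GenTree.tree nat) : option formula :=
  match t with
  | GenTree.Leaf n => Some (Var n)
  | GenTree.Node 0 [::] => Some Bot
  | GenTree.Node 1 [:: t1; t2] =>
      if (formula_of_tree t1, formula_of_tree t2) is (Some phi1, Some phi2)
      then Some (Imp phi1 phi2) else None
  | GenTree.Node 2 [:: t1] => omap Box (formula_of_tree t1)
  | _ => None
  end.

Lemma tree_of_formulaK : pcancel tree_of_formula formula_of_tree.
Proof. by elim=> //= [phi1 -> phi2 ->|phi ->]. Qed.

HB.instance Definition _ := Countable.copy formula (pcan_type tree_of_formulaK).

Definition Neg (phi : formula) : formula := Imp phi Bot.
Definition Top : formula := Neg Bot.
Definition Or (phi psi : formula) : formula := Imp (Neg phi) psi.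
Definition And (phi psi : formula) : formula := Neg (Imp phi (Neg psi)).

(* The conjuncts (disjuncts) are taken in the order of the canonical
   enumeration of the set, ending with the unit Top (Bot); another order or
   bracketing gives a formula that is tautologically equivalent. *)
Definition bigAnd (G : {fset formula}) : formula :=
  \big[And/Top]_(phi <- G) phi.
Definition bigOr (G : {fset formula}) : formula :=
  \big[Or/Bot]_(phi <- G) phi.

Definition boxes (G : {fset formula}) : {fset formula} :=
  [fset Box phi | phi in G].

Inductive arrow : Type := ArrGL | ArrS | ArrD.

Definition nat_of_arrow (a : arrow) : nat :=
  match a with ArrGL => 0 | ArrS => 1 | ArrD => 2 end.
Definition arrow_of_nat (n : nat) : arrow :=
  match n with 0 => ArrGL | 1 => ArrS | _ => ArrD end.
Lemma nat_of_arrowK : cancel nat_of_arrow arrow_of_nat.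
Proof. by case. Qed.

HB.instance Definition _ := Countable.copy arrow (can_type nat_of_arrowK).

Notation sequent := (arrow * {fset formula} * {fset formula})%type.

Notation "G |>[ a ] D" := ((a, G, D) : sequent)
  (at level 70, a at level 50, D at next level, format "G  |>[ a ]  D").

(* [R ps s] means that the sequent [s] follows from the premises [ps] by one
   instance of a rule of [R]; initial sequents are rules without premises. *)
Definition ruleset : Type := seq sequent -> sequent -> Prop.

Inductive derivable (R : ruleset) : sequent -> Prop :=
| derivable_step (ps : seq sequent) (s : sequent) :
    R ps s -> (forall p, p \in ps -> derivable R p) -> derivable R s.

Inductive LK (a : arrow) : ruleset :=
| LK_init phi :
    LK a [::] ([fset phi] |>[a] [fset phi])
| LK_bot :
    LK a [::] ([fset Bot] |>[a] fset0)
| LK_weak (G D G' D' : {fset formula}) :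
    G `<=` G' -> D `<=` D' ->
    LK a [:: G |>[a] D] (G' |>[a] D')
| LK_impL (G D : {fset formula}) phi psi :
    LK a [:: G |>[a] D `|` [fset phi]; psi |` G |>[a] D]
         (Imp phi psi |` G |>[a] D)
| LK_impR (G D : {fset formula}) phi psi :
    LK a [:: phi |` G |>[a] D `|` [fset psi]]
         (G |>[a] D `|` [fset Imp phi psi])
| LK_cut (G D P S : {fset formula}) phi :
    LK a [:: G |>[a] D `|` [fset phi]; phi |` P |>[a] S]
         (G `|` P |>[a] D `|` S).

Inductive GLBox : ruleset :=
| GLBox_rule (G : {fset formula}) phi :
    GLBox [:: G `|` boxes G `|` [fset Box phi] |>[ArrGL] [fset phi]]
          (boxes G |>[ArrGL] [fset Box phi]).

Inductive GLtoS : ruleset :=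
| GLtoS_rule (G D : {fset formula}) :
    GLtoS [:: G |>[ArrGL] D] (G |>[ArrS] D).

Inductive SBoxLeft : ruleset :=
| SBoxLeft_rule (G D : {fset formula}) phi :
    SBoxLeft [:: phi |` G |>[ArrS] D] (Box phi |` G |>[ArrS] D).

Inductive GLtoD : ruleset :=
| GLtoD_rule (G D : {fset formula}) :
    GLtoD [:: G `|` boxes G |>[ArrGL] boxes D] (boxes G |>[ArrD] boxes D).

Inductive StoD : ruleset :=
| StoD_rule (G D : {fset formula}) :
    StoD [:: boxes G |>[ArrS] boxes D] (boxes G |>[ArrD] boxes D).

Definition D2seq : ruleset := fun ps s =>
  [\/ LK ArrGL ps s, LK ArrD ps s, GLBox ps s | GLtoD ps s].

Inductive D3seq (ps : seq sequent) (s : sequent) : Prop :=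
| D3_LK_GL of LK ArrGL ps s
| D3_LK_S of LK ArrS ps s
| D3_LK_D of LK ArrD ps s
| D3_GLBox of GLBox ps s
| D3_GLtoS of GLtoS ps s
| D3_SBoxLeft of SBoxLeft ps s
| D3_StoD of StoD ps s.

(* A tautology of the modal language: boxed formulas are evaluated as if they
   were additional propositional variables. *)
Fixpoint truth (v : nat -> bool) (b : formula -> bool) (phi : formula) : bool :=
  match phi with
  | Var n => v n
  | Bot => false
  | Imp phi1 phi2 => truth v b phi1 ==> truth v b phi2
  | Box phi1 => b phi1
  end.

Definition tautology (phi : formula) : Prop := forall v b, truth v b phi.

Inductive GLH : formula -> Prop :=
| GLH_taut phi : tautology phi -> GLH phi
| GLH_K phi psi :
    GLH (Imp (Box (Imp phi psi)) (Imp (Box phi) (Box psi)))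
| GLH_Lob phi : GLH (Imp (Box (Imp (Box phi) phi)) (Box phi))
| GLH_MP phi psi : GLH (Imp phi psi) -> GLH phi -> GLH psi
| GLH_Nec phi : GLH phi -> GLH (Box phi).

Inductive DH : formula -> Prop :=
| DH_GL phi : GLH phi -> DH phi
| DH_con : DH (Neg (Box Bot))
| DH_disj phi psi :
    DH (Imp (Box (Or (Box phi) (Box psi))) (Or (Box phi) (Box psi)))
| DH_MP phi psi : DH (Imp phi psi) -> DH phi -> DH psi.

(* Main.v *)
(* (i) -> (ii): GLtoD is GLtoS, followed by S[]left for each formula of G, and
   StoD.  (iii) -> (i): LK proves every tautology, so with cut it suffices to
   derive the axioms of D_H; each is an instance of GL[] or GLtoD up to
   tautological consequence.  (ii) -> (iii): a derivable S-sequent is a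
   GL-consequence of finitely many reflection formulas []psi -> psi, and those
   are eliminated one at a time when the conclusion is a disjunction of boxed
   formulas. *)
Require Import Defs.
From mathcomp Require Import all_boot finmap.
From mathcomp Require Import zify.

Set Implicit Arguments.
Unset Strict Implicit.
Unset Printing Implicit Defensive.

Local Open Scope fset_scope.

(** * Boolean quantifiers over finite sets *)

Section FsetPredicates.
Variable K : choiceType.
Implicit Types (p : pred K) (A B : {fset K}) (s : seq K).

Lemma all_fsetU p A B : all p (A `|` B) = all p A && all p B.
Proof.
apply/allP/andP=> [h|[/allP hA /allP hB] x].
  by split; apply/allP=> x xA; apply: h; rewrite inE xA ?orbT.
by rewrite inE => /orP[/hA|/hB].
Qed.

Lemma all_fset1 p x : all p [fset x] = p x.
Proof.
by apply/allP/idP=> [-> //|px y]; rewrite inE // => /eqP->.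
Qed.

Lemma all_fset_seq p s : all p [fset x in s] = all p s.
Proof. by apply/allP/allP=> h x xs; apply: h; rewrite inE in xs *. Qed.

Lemma has_fsetU p A B : has p (A `|` B) = has p A || has p B.
Proof. by apply/negb_inj; rewrite negb_or -!all_predC all_fsetU. Qed.

Lemma has_fset1 p x : has p [fset x] = p x.
Proof. by apply/negb_inj; rewrite -all_predC all_fset1. Qed.

Lemma has_fset_seq p s : has p [fset x in s] = has p s.
Proof. by apply/negb_inj; rewrite -!all_predC all_fset_seq. Qed.

End FsetPredicates.

(** * Sequents read as formulas, and their truth values *)

Definition interp (G D : {fset formula}) : formula := Imp (bigAnd G) (bigOr D).

Section Truth.
Variables (v : nat -> bool) (b : formula -> bool).

Lemma truth_And phi psi :
  truth v b (And phi psi) = truth v b phi && truth v b psi.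
Proof. by rewrite /=; case: (truth v b phi); case: (truth v b psi). Qed.

Lemma truth_Or phi psi :
  truth v b (Or phi psi) = truth v b phi || truth v b psi.
Proof. by rewrite /=; case: (truth v b phi); case: (truth v b psi). Qed.

Lemma truth_bigAnd G : truth v b (bigAnd G) = all (truth v b) G.
Proof.
rewrite /bigAnd; elim: (enum_fset G) => [|phi s IHs]; first by rewrite big_nil.
by rewrite big_cons truth_And IHs.
Qed.

Lemma truth_bigOr G : truth v b (bigOr G) = has (truth v b) G.
Proof.
rewrite /bigOr; elim: (enum_fset G) => [|phi s IHs]; first by rewrite big_nil.
by rewrite big_cons truth_Or IHs.
Qed.

Lemma truth_interp G D :
  truth v b (interp G D) = (all (truth v b) G ==> has (truth v b) D).
Proof. by rewrite /= truth_bigAnd truth_bigOr. Qed.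

Lemma all_boxes G : all (truth v b) (boxes G) = all b G.
Proof.
apply/allP/allP=> h phi.
  by move=> phiG; apply: (h (Box phi)); apply: in_imfset.
by case/imfsetP=> psi /= psiG ->; apply: h.
Qed.

Lemma has_boxes G : has (truth v b) (boxes G) = has b G.
Proof.
apply/hasP/hasP=> -[phi].
  by case/imfsetP=> psi /= psiG -> bpsi; exists psi.
by move=> phiG bphi; exists (Box phi) => //; apply: in_imfset.
Qed.

Lemma truth_imps s phi :
  truth v b (foldr Imp phi s) = (all (truth v b) s ==> truth v b phi).
Proof. by elim: s => //= psi s ->; case: (truth v b psi). Qed.

End Truth.

Definition truthE := (truth_interp, truth_imps, truth_And, truth_Or,
  truth_bigAnd, truth_bigOr, all_boxes, has_boxes, all_fsetU, all_fset1,
  all_fset_seq, has_fsetU, has_fset1, has_fset_seq).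

Ltac bool_cases :=
  repeat match goal with
  | |- context [truth ?v ?b ?x] => case: (truth v b x)
  | b : formula -> bool |- _ =>
      match goal with |- context [b ?x] => case: (b x) end
  | |- context [all ?p ?x] => case: (all p x)
  | |- context [has ?p ?x] => case: (has p x)
  end => //=.

Ltac sub_fset := apply/fsubsetP=> ?; rewrite ?inE;
  repeat match goal with |- context [?x == ?y] => case: (x == y) => //= end;
  repeat match goal with |- context [?x \in ?y] => case: (x \in y) => //= end.

(** * Tautological consequence and soundness of LK *)

Definition classical_logic (L : formula -> Prop) : Prop :=
  (forall phi, tautology phi -> L phi) /\
  (forall phi psi, L (Imp phi psi) -> L phi -> L psi).

(** The nested implication from [ps] to [phi] is itself a tautology, and modus ponens discharges its
    premises one by one. Propositional reasoning in [GLH], [SL] and [DH] thereby becomes a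
    truth-table check. *)
Lemma taut_consequence L (ps : seq formula) phi :
  classical_logic L -> (forall psi, psi \in ps -> L psi) ->
  (forall v b, all (truth v b) ps -> truth v b phi) -> L phi.
Proof.
move=> [Ltaut LMP] Lps h.
have: L (foldr Imp phi ps).
  by apply: Ltaut => v b; rewrite truth_imps; apply/implyP/h.
elim: ps Lps {h} => //= psi ps IHps Lps /LMP h.
by apply: IHps; [move=> chi hchi; apply: Lps; rewrite inE hchi orbT|
  apply/h/Lps/mem_head].
Qed.

Lemma LK_sound L a ps s :
  classical_logic L -> LK a ps s ->
  (forall p, p \in ps -> L (interp p.1.2 p.2)) -> L (interp s.1.2 s.2).
Proof.
move=> cL LKs Lps.
apply: (taut_consequence (ps := [seq interp p.1.2 p.2 | p <- ps]) cL).
  by move=> phi /mapP[p /Lps Lp ->].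
move=> v b; case: LKs {Lps} => /=.
- by move=> phi; rewrite !truthE implybb.
- by rewrite !truthE.
- move=> G D G' D' /fsubsetP sG /fsubsetP sD.
  rewrite !truthE andbT => /implyP h.
  apply/implyP=> /allP hG'; have /h/hasP[phi /sD phiD' tphi]: all (truth v b) G.
    by apply/allP=> phi /sG; apply: hG'.
  by apply/hasP; exists phi.
- by move=> G D phi psi; rewrite !truthE /=; bool_cases.
- by move=> G D phi psi; rewrite !truthE /=; bool_cases.
- by move=> G D P S phi; rewrite !truthE /=; bool_cases.
Qed.

(** * Propositional completeness of any calculus containing LK *)

Definition is_imp (phi : formula) : bool :=
  if phi is Imp _ _ then true else false.

Section LKDerivability.
Variables (R : ruleset) (a : arrow).
Hypothesis LK_R : forall ps s, LK a ps s -> R ps s.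
Implicit Types (G D : {fset formula}).

Lemma derivable_weak G D G' D' : G `<=` G' -> D `<=` D' ->
  derivable R (G |>[a] D) -> derivable R (G' |>[a] D').
Proof.
move=> sG sD d; apply: (derivable_step (LK_R (LK_weak a sG sD))) => p.
by rewrite inE => /eqP->.
Qed.

Lemma derivable_init phi G D :
  phi \in G -> phi \in D -> derivable R (G |>[a] D).
Proof.
move=> pG pD; apply: (@derivable_weak [fset phi] [fset phi]);
  rewrite ?fsub1set //.
exact: (derivable_step (LK_R (LK_init a phi))).
Qed.

Lemma derivable_cut phi G D :
  derivable R (G |>[a] D `|` [fset phi]) ->
  derivable R (phi |` G |>[a] D) -> derivable R (G |>[a] D).
Proof.
move=> d1 d2; rewrite -(fsetUid G) -(fsetUid D).
apply: (derivable_step (LK_R (LK_cut a G D G D phi))) => p.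
by rewrite !inE => /orP[] /eqP->.
Qed.

(** Without implications, [G] defines its own valuation: exactly the variables and boxed formulas in
    [G] are true. If [Bot] is not in [G], all of [G] holds there, so validity yields a true member
    of [D], which must then lie in [G]. *)
Lemma derivable_atomic G D :
  (forall phi, phi \in G `|` D -> ~~ is_imp phi) ->
  (forall v b, truth v b (interp G D)) -> derivable R (G |>[a] D).
Proof.
move=> atom valid.
have := valid (fun n => Var n \in G) (fun phi => Box phi \in G).
set v := fun n => _; set b := fun phi => _.
have [BotG _|BotG] := boolP (Bot \in G).
  apply: (@derivable_weak [fset Bot] fset0); rewrite ?fsub1set ?fsub0set //.
  exact: (derivable_step (LK_R (LK_bot a))).
rewrite truth_interp => /implyP h.
have /h/hasP[phi phiD tphi] : all (truth v b) G.
  apply/allP=> phi phiG; have := atom phi; rewrite inE phiG => /(_ isT).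
  by case: phi phiG => //=; move: BotG => /negP BotG /BotG.
apply: (derivable_init (phi := phi)) => //.
have := atom phi; rewrite inE phiD orbT => /(_ isT).
by case: phi phiD tphi.
Qed.

(** Boxed formulas count as atoms. Weights are positive and that of an implication exceeds the sum
    of its parts, so the total drops both when an implication is decomposed and when an atom leaves
    the lists. *)
Fixpoint weight (phi : formula) : nat :=
  if phi is Imp phi1 phi2 then (weight phi1 + weight phi2).+1 else 1.

Lemma derivable_impL G D phi psi :
  derivable R (G |>[a] phi |` D) -> derivable R (psi |` G |>[a] D) ->
  derivable R (Imp phi psi |` G |>[a] D).
Proof.
rewrite fsetUC => d1 d2.
apply: (derivable_step (LK_R (LK_impL a G D phi psi))) => p.
by rewrite !inE => /orP[] /eqP->.
Qed.

Lemma derivable_impR G D phi psi :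
  derivable R (phi |` G |>[a] psi |` D) ->
  derivable R (G |>[a] Imp phi psi |` D).
Proof.
rewrite ![_ |` D]fsetUC => d.
apply: (derivable_step (LK_R (LK_impR a G D phi psi))) => p.
by rewrite !inE => /eqP->.
Qed.

(* The formulas still to be decomposed are kept in the lists s and t. *)
Lemma derivable_worklist n G D (s t : seq formula) :
  sumn (map weight s) + sumn (map weight t) <= n ->
  (forall phi, phi \in G `|` D -> ~~ is_imp phi) ->
  (forall v b,
     truth v b (interp (G `|` [fset x in s]) (D `|` [fset x in t]))) ->
  derivable R (G `|` [fset x in s] |>[a] D `|` [fset x in t]).
Proof.
elim: n G D s t => [|n IHn] G D [|phi s] t le_n atom valid.
- case: t le_n valid => [|phi t] le_n valid; last by case: phi le_n {valid}.
  apply: derivable_atomic => // phi h; apply: atom.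
  by move: h; rewrite !inE !orbF.
- by case: phi le_n {valid}.
- case: t le_n valid => [|phi t] le_n valid.
    apply: derivable_atomic => // phi h; apply: atom.
    by move: h; rewrite !inE !orbF.
  have [iphi|aphi] := boolP (is_imp phi).
    case: phi iphi le_n valid => // phi psi _ le_n valid.
    (* Weakening between equal sets regroups the union so that the implication becomes principal. *)
    apply: (@derivable_weak (G `|` [fset x in [::]])
      (Imp phi psi |` (D `|` [fset x in t]))); [by sub_fset..|].
    apply: derivable_impR.
    have d : derivable R
        (G `|` [fset x in [:: phi]] |>[a] D `|` [fset x in psi :: t]).
      apply: IHn => // [|v b]; first by move: le_n => /=; lia.
      by move: (valid v b); rewrite !truthE /=; bool_cases.
    by move: d; apply: derivable_weak; sub_fset.
  (* An atomic [phi] moves from the list to the finished part [D]. *)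
  have d : derivable R
      (G `|` [fset x in [::]] |>[a] (phi |` D) `|` [fset x in t]).
    apply: IHn => // [|psi|v b].
    - by move: le_n; case: (phi) aphi.
    - rewrite !inE => /or3P[h|/eqP->//|h]; by apply: atom; rewrite inE h ?orbT.
    - by move: (valid v b); rewrite !truthE /=; bool_cases.
  by move: d; apply: derivable_weak; sub_fset.
have [iphi|aphi] := boolP (is_imp phi).
  case: phi iphi le_n valid => // phi psi _ le_n valid.
  apply: (@derivable_weak (Imp phi psi |` (G `|` [fset x in s]))
    (D `|` [fset x in t])); [by sub_fset..|].
  apply: derivable_impL.
    have d : derivable R
        (G `|` [fset x in s] |>[a] D `|` [fset x in phi :: t]).
      apply: IHn => // [|v b]; last first.
        by move: (valid v b); rewrite !truthE /=; bool_cases.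
      by move: le_n => /=; lia.
    by move: d; apply: derivable_weak; sub_fset.
  have d : derivable R
      (G `|` [fset x in psi :: s] |>[a] D `|` [fset x in t]).
    apply: IHn => // [|v b]; last first.
      by move: (valid v b); rewrite !truthE /=; bool_cases.
    by move: le_n => /=; lia.
  by move: d; apply: derivable_weak; sub_fset.
have d : derivable R
    ((phi |` G) `|` [fset x in s] |>[a] D `|` [fset x in t]).
  apply: IHn => // [|psi|v b].
  - by move: le_n; case: (phi) aphi.
  - by rewrite -fsetUA inE => /orP[|/atom//]; rewrite inE => /eqP->.
  - by move: (valid v b); rewrite !truthE /=; bool_cases.
by move: d; apply: derivable_weak; sub_fset.
Qed.

(** The decomposition starts with every formula still on the lists and nothing finished. *)
Lemma derivable_valid G D :
  (forall v b, truth v b (interp G D)) -> derivable R (G |>[a] D).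
Proof.
move=> valid.
have := derivable_worklist (s := enum_fset G) (t := enum_fset D) (leqnn _).
move=> /(_ fset0 fset0) d; apply: (derivable_weak _ _ (d _ _)).
- by sub_fset.
- by sub_fset.
- by move=> phi; rewrite fsetU0 in_fset0.
by move=> v b; rewrite truth_interp !fset0U !truthE -truth_interp.
Qed.

Lemma derivable_cuts_left (s : seq formula) G D :
  (forall phi, phi \in s -> derivable R (G |>[a] phi |` D)) ->
  derivable R (G `|` [fset x in s] |>[a] D) -> derivable R (G |>[a] D).
Proof.
elim: s G => [|phi s IHs] G ds d.
  by move: d; apply: derivable_weak; sub_fset.
apply: (@derivable_cut phi); first by rewrite fsetUC; apply/ds/mem_head.
apply: IHs => [psi psis|]; last by move: d; apply: derivable_weak; sub_fset.
have := ds psi; rewrite inE psis orbT => /(_ isT).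
by apply: derivable_weak; sub_fset.
Qed.

Lemma derivable_cuts_right (s : seq formula) G D :
  (forall phi, phi \in s -> derivable R (phi |` G |>[a] D)) ->
  derivable R (G |>[a] D `|` [fset x in s]) -> derivable R (G |>[a] D).
Proof.
elim: s D => [|phi s IHs] D ds d.
  by move: d; apply: derivable_weak; sub_fset.
apply: (@derivable_cut phi); last by apply/ds/mem_head.
apply: IHs => [psi psis|]; last by move: d; apply: derivable_weak; sub_fset.
have := ds psi; rewrite inE psis orbT => /(_ isT).
by apply: derivable_weak; sub_fset.
Qed.

(** Each member of [G] can be cut in because [interp G D] is true whenever that member is false;
    each member of [D] can be cut out because its truth makes [interp G D] true. *)
Lemma derivable_interp G D :
  derivable R (G |>[a] D) -> derivable R (fset0 |>[a] [fset interp G D]).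
Proof.
move=> d; apply: (derivable_cuts_left (s := enum_fset G)) => [phi phiG|].
  apply: derivable_valid => v b; rewrite !truthE /=.
  have [/allP/(_ _ phiG)->//|] := boolP (all _ G).
  by rewrite orbT.
apply: (derivable_cuts_right (s := enum_fset D)) => [phi phiD|].
  apply: derivable_valid => v b; rewrite !truthE /=.
  have [_|/hasPn/(_ _ phiD)/negbTE->//] := boolP (has _ D).
  by rewrite !implybT.
by move: d; apply: derivable_weak; sub_fset.
Qed.

(** Once the premises are turned into formulas and cut in, the remaining sequent is propositionally
    valid. *)
Lemma derivable_consequence (ps : seq ({fset formula} * {fset formula})) G D :
  (forall p, p \in ps -> derivable R (p.1 |>[a] p.2)) ->
  (forall v b, all (fun p => truth v b (interp p.1 p.2)) ps ->
     truth v b (interp G D)) ->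
  derivable R (G |>[a] D).
Proof.
move=> dps h.
apply: (derivable_cuts_left (s := [seq interp p.1 p.2 | p <- ps])).
  move=> phi /mapP[p /dps/derivable_interp d ->].
  by move: d; apply: derivable_weak; sub_fset.
apply: derivable_valid => v b; have := h v b.
rewrite !truthE all_map /preim /=.
have -> : all (fun p => truth v b (interp p.1 p.2)) ps =
  all [pred p | truth v b (interp p.1 p.2)] ps by [].
by case: (all [pred p | _] ps) => [/(_ isT)|_]; bool_cases.
Qed.

Lemma derivable_consequence1 G D G' D' :
  derivable R (G |>[a] D) ->
  (forall v b, truth v b (interp G D) -> truth v b (interp G' D')) ->
  derivable R (G' |>[a] D').
Proof.
move=> d h; apply: (derivable_consequence (ps := [:: (G, D)])).
  by move=> p; rewrite inE => /eqP->.
by move=> v b; rewrite [all _ _]/= andbT; apply: h.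
Qed.

Lemma derivable_MP phi psi :
  derivable R (fset0 |>[a] [fset Imp phi psi]) ->
  derivable R (fset0 |>[a] [fset phi]) -> derivable R (fset0 |>[a] [fset psi]).
Proof.
move=> d1 d2; apply: (derivable_consequence
  (ps := [:: (fset0, [fset Imp phi psi]); (fset0, [fset phi])])).
  by move=> p; rewrite !inE => /orP[] /eqP->.
by move=> v b; rewrite /= !truthE /= andbT; bool_cases.
Qed.

End LKDerivability.

(** * Modal reasoning in the Hilbert system for GL *)

Lemma taut_consequence1 L phi psi :
  classical_logic L -> L phi ->
  (forall v b, truth v b phi -> truth v b psi) -> L psi.
Proof.
move=> cL Lphi h; apply: (taut_consequence (ps := [:: phi]) cL).
  by move=> chi; rewrite inE => /eqP->.
by move=> v b; rewrite /= andbT; apply: h.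
Qed.

Lemma taut_consequence2 L phi psi chi :
  classical_logic L -> L phi -> L psi ->
  (forall v b, truth v b phi -> truth v b psi -> truth v b chi) -> L chi.
Proof.
move=> cL Lphi Lpsi h; apply: (taut_consequence (ps := [:: phi; psi]) cL).
  by move=> xi; rewrite !inE => /orP[] /eqP->.
by move=> v b; rewrite /= andbT => /andP[]; apply: h.
Qed.

Lemma GLH_classical : classical_logic GLH.
Proof. by split; [exact: GLH_taut|exact: GLH_MP]. Qed.

Lemma DH_classical : classical_logic DH.
Proof.
by split; [move=> phi /GLH_taut; exact: DH_GL|exact: DH_MP].
Qed.

Lemma GLH_box_mono phi psi :
  GLH (Imp phi psi) -> GLH (Imp (Box phi) (Box psi)).
Proof. by move/GLH_Nec; apply: GLH_MP; apply: GLH_K. Qed.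

Lemma GLH_four phi : GLH (Imp (Box phi) (Box (Box phi))).
Proof.
(* Loeb's axiom for phi /\ []phi. *)
pose psi := And phi (Box phi).
have psiE : GLH (Imp (Box psi) (Box phi)).
  by apply/GLH_box_mono/GLH_taut => v b /=; bool_cases.
have psi_box : GLH (Imp (Box psi) (Box (Box phi))).
  by apply/GLH_box_mono/GLH_taut => v b /=; bool_cases.
(* Given [phi], the assumption [Box psi] yields [Box phi], hence both conjuncts of [psi]. *)
have: GLH (Imp (Box phi) (Box (Imp (Box psi) psi))).
  apply: GLH_box_mono; apply: (taut_consequence1 GLH_classical psiE) => v b /=.
  by bool_cases.
move=> h1; have h2 := GLH_Lob psi.
have h3 : GLH (Imp (Box phi) (Box psi)).
  apply: (taut_consequence2 GLH_classical h1 h2) => v b /=.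
  by move=> /implyP h /implyP h'; apply/implyP=> /h /h'.
apply: (taut_consequence2 GLH_classical h3 psi_box) => v b /=.
by move=> /implyP h /implyP h'; apply/implyP=> /h /h'.
Qed.

Lemma GLH_box_imps s phi :
  GLH (Imp (Box (foldr Imp phi s)) (foldr Imp (Box phi) (map Box s))).
Proof.
elim: s => [|psi s IHs] /=; first by apply: GLH_taut => v b /=; rewrite implybb.
apply: (taut_consequence2 GLH_classical (GLH_K psi (foldr Imp phi s)) IHs).
by move=> v b /=; do 3!case: (b _) => //=.
Qed.

(** Necessitation and iterated K box the whole implication. This asks for [Box (Box psi)] for each
    [psi] in [G], which the transitivity law [GLH_four] supplies. *)
Lemma GLH_box_context G phi :
  GLH (Imp (bigAnd (G `|` boxes G)) phi) ->
  GLH (Imp (bigAnd (boxes G)) (Box phi)).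
Proof.
move=> h; pose s := enum_fset G ++ map Box (enum_fset G).
have /GLH_Nec/(GLH_MP (GLH_box_imps _ _)) hs : GLH (foldr Imp phi s).
  apply: (taut_consequence1 GLH_classical h) => v b.
  by rewrite truth_imps /= truth_bigAnd all_fsetU all_boxes all_cat all_map.
pose four psi := Imp (Box psi) (Box (Box psi)).
apply: (taut_consequence (ps := foldr Imp (Box phi) (map Box s) ::
                                map four (enum_fset G)) GLH_classical).
  by move=> psi; rewrite inE => /orP[/eqP->//|/mapP[chi _ ->]]; apply: GLH_four.
move=> v b /=; rewrite truth_imps truth_bigAnd all_boxes !all_map all_cat.
rewrite all_map => /andP[/implyP hphi /allP hfour].
apply/implyP=> /allP bG; apply: hphi.
apply/andP; split; apply/allP=> // psi psiG.
by have := hfour psi psiG; rewrite /= (bG _ psiG).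
Qed.

(** With [Box phi] moved to the right, the premise says that the context implies
    [Imp (Box phi) phi]; boxing this gives the antecedent of Loeb's axiom. *)
Lemma GLH_GLBox G phi :
  GLH (interp (G `|` boxes G `|` [fset Box phi]) [fset phi]) ->
  GLH (interp (boxes G) [fset Box phi]).
Proof.
move=> h; have /GLH_box_context h' :
    GLH (Imp (bigAnd (G `|` boxes G)) (Imp (Box phi) phi)).
  apply: (taut_consequence1 GLH_classical h) => v b.
  by rewrite !truthE /= !truthE; bool_cases; case: (b phi).
apply: (taut_consequence2 GLH_classical h' (GLH_Lob phi)) => v b.
rewrite !truthE /= !truthE => /implyP h1 /implyP h2.
by apply/implyP=> /h1 /h2.
Qed.

(** * Disjunctions of boxed formulas, and soundness of [GLtoD] *)

Definition disj_boxes (s : seq formula) : formula := foldr Or Bot (map Box s).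

Lemma truth_disj_boxes v b s : truth v b (disj_boxes s) = has b s.
Proof. by elim: s => // phi s IHs; rewrite [LHS]truth_Or IHs. Qed.

(** Each disjunct implies its own box by transitivity, and that box weakens to the box of the
    disjunction. *)
Lemma GLH_disj_boxes_four s : GLH (Imp (disj_boxes s) (Box (disj_boxes s))).
Proof.
pose ps := [seq Imp (Box phi) (Box (disj_boxes s)) | phi <- s].
apply: (taut_consequence (ps := ps) GLH_classical).
  move=> psi /mapP[phi phis ->].
  have : GLH (Imp (Box (Box phi)) (Box (disj_boxes s))).
    apply/GLH_box_mono/GLH_taut => v b; rewrite /= truth_disj_boxes.
    by apply/implyP=> bphi; apply/hasP; exists phi.
  move/(taut_consequence2 GLH_classical (GLH_four phi)); apply=> v b /=.
  by bool_cases.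
move=> v b; rewrite all_map /= truth_disj_boxes => /allP h.
by apply/implyP=> /hasP[phi /h /= /implyP]; apply.
Qed.

(** The D axioms in n-ary form, by induction: the empty disjunction is [Bot], so [DH_con] is the
    base case. *)
Lemma DH_disj_boxes s : DH (Imp (Box (disj_boxes s)) (disj_boxes s)).
Proof.
elim: s => [|phi s IHs]; first exact: DH_con.
(* The binary axiom needs two boxed disjuncts, so the tail is first boxed inside; the induction
   hypothesis later removes that box. *)
have mono : DH (Imp (Box (disj_boxes (phi :: s)))
                    (Box (Or (Box phi) (Box (disj_boxes s))))).
  apply/DH_GL/GLH_box_mono.
  apply: (taut_consequence1 GLH_classical (GLH_disj_boxes_four s)) => v b.
  rewrite /= truth_disj_boxes /=.
  by bool_cases.
have h : DH (Imp (Box (disj_boxes (phi :: s)))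
                 (Or (Box phi) (Box (disj_boxes s)))).
  apply: (taut_consequence2 DH_classical mono (DH_disj phi (disj_boxes s))).
  by move=> v b /= /implyP h1 /implyP h2; apply/implyP=> /h1 /h2.
apply: (taut_consequence2 DH_classical h IHs) => v b.
by rewrite /= !truth_disj_boxes /=; bool_cases.
Qed.

(** Boxing the GL implication puts one box around the disjunction of [boxes D], and [DH_disj_boxes]
    strips it. *)
Lemma DH_GLtoD G D :
  GLH (interp (G `|` boxes G) (boxes D)) -> DH (interp (boxes G) (boxes D)).
Proof.
move=> h; have /GLH_box_context/DH_GL h' :
    GLH (Imp (bigAnd (G `|` boxes G)) (disj_boxes (enum_fset D))).
  apply: (taut_consequence1 GLH_classical h) => v b.
  by rewrite truth_interp /= truth_bigAnd truth_disj_boxes has_boxes.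
apply: (taut_consequence2 DH_classical h' (DH_disj_boxes (enum_fset D))) => v b.
rewrite truth_interp /= truth_disj_boxes has_boxes truth_bigAnd.
by move=> /implyP h1 /implyP h2; apply/implyP=> /h1 /h2.
Qed.

(** * The logic S as GL with reflection, and elimination of reflection in D *)

Definition reflection (phi : formula) : formula := Imp (Box phi) phi.

(** The instances of reflection form an explicit list, so that an induction on its length can
    eliminate them. *)
Definition SL (phi : formula) : Prop :=
  exists ps, GLH (foldr Imp phi (map reflection ps)).

Lemma GLH_SL phi : GLH phi -> SL phi.
Proof. by exists [::]. Qed.

Lemma SL_classical : classical_logic SL.
Proof.
split=> [phi /GLH_taut/GLH_SL //|phi psi [ps hps] [qs hqs]].
exists (ps ++ qs); apply: (taut_consequence2 GLH_classical hps hqs) => v b.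
rewrite !truth_imps map_cat all_cat /= => /implyP h1 /implyP h2.
by apply/implyP=> /andP[/h1/implyP h /h2 /h].
Qed.

Lemma SL_reflection phi : SL (reflection phi).
Proof.
by exists [:: phi]; apply: GLH_taut => v b /=; rewrite implybb.
Qed.

(* If every reflection instance []psi -> psi with psi in ps holds, there is
   nothing to prove; otherwise []psi holds for one of them.  As the disjunction
   of the []psi and of []D consists of boxed formulas, D decides it, and in the
   case []psi the instance for psi follows from psi, which joins G. *)
Lemma DH_StoD G D :
  SL (interp (G `|` boxes G) (boxes D)) -> DH (interp (boxes G) (boxes D)).
Proof.
case=> ps; have [n] := ubnP (size ps).
elim: n G ps => // n IHn G ps le_n h.
have split : DH (interp (boxes G) (boxes (D `|` [fset x in ps]))).
  apply: DH_GLtoD; apply: (taut_consequence1 GLH_classical h) => v b.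
  rewrite truth_imps !truth_interp !has_boxes has_fsetU has_fset_seq.
  (* If no [Box psi] with [psi] in [ps] is true, every reflection instance holds vacuously. *)
  have [_|/hasPn hps] := boolP (has b ps); first by rewrite orbT !implybT.
  have -> : all (truth v b) (map reflection ps).
    by rewrite all_map; apply/allP=> psi /hps /= /negbTE->.
  by rewrite orbF.
pose qs := [seq interp (boxes (psi |` G)) (boxes D) | psi <- ps].
apply: (taut_consequence (ps := interp (boxes G) (boxes (D `|` [fset x in ps]))
                           :: qs) DH_classical).
  move=> phi; rewrite inE => /orP[/eqP->//|/mapP[psi psips ->]].
  apply: (IHn _ (rem psi ps)).
    by rewrite size_rem //; case: (ps) psips le_n.
  apply: (taut_consequence1 GLH_classical h) => v b.
  rewrite !truth_imps (perm_all _ (perm_map reflection (perm_to_rem psips))).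
  rewrite !truthE /=.
  by case: (truth v b psi); bool_cases; rewrite implybT.
move=> v b /=; rewrite all_map !truthE => /andP[/implyP h1 /allP h2].
apply/implyP=> bG; have /orP[//|/hasP[psi psips bpsi]] := h1 bG.
by have := h2 _ psips; rewrite /= !truthE bpsi bG.
Qed.

(** * Soundness of the three-arrow calculus *)

Lemma D3seq_sound s : derivable D3seq s ->
  match s.1.1 with ArrGL => GLH | ArrS => SL | ArrD => DH end
    (interp s.1.2 s.2).
Proof.
elim=> {s} ps s Rs _ IH.
(* Premises and conclusion of an LK rule share one arrow, so all are read in the same logic. *)
have LKcase a L : classical_logic L -> LK a ps s ->
    L = match a with ArrGL => GLH | ArrS => SL | ArrD => DH end ->
    match s.1.1 with ArrGL => GLH | ArrS => SL | ArrD => DH end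
      (interp s.1.2 s.2).
  move=> cL LKs LE; have -> : s.1.1 = a by case: LKs.
  rewrite -LE; apply: (LK_sound cL LKs) => p pps.
  have := IH p pps; have -> : p.1.1 = a; last by rewrite -LE.
  by case: LKs p pps {IH} => [phi||G D G' D' _ _|G D phi psi|G D phi psi|
    G D P S phi] p; rewrite ?inE // => *;
    repeat match goal with H : is_true (_ || _) |- _ => case/orP: H end;
    move=> *; match goal with H : is_true (_ == _) |- _ => rewrite (eqP H) end.
case: Rs => [LKs|LKs|LKs|Rs|Rs|Rs|Rs].
- exact: (LKcase _ _ GLH_classical LKs).
- exact: (LKcase _ _ SL_classical LKs).
- exact: (LKcase _ _ DH_classical LKs).
- by case: Rs IH => G phi /(_ _ (mem_head _ _)) /= /GLH_GLBox.
- by case: Rs IH => G D /(_ _ (mem_head _ _)) /= /GLH_SL.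
- case: Rs IH => G D phi /(_ _ (mem_head _ _)) /= h.
  apply: (taut_consequence2 SL_classical h (SL_reflection phi)) => v b.
  by rewrite !truthE /=; case: (b phi); bool_cases.
case: Rs IH => G D /(_ _ (mem_head _ _)) /= h; apply: DH_StoD.
(* Weakening by the unboxed [G] gives the form of context on which reflection elimination works. *)
apply: (taut_consequence1 SL_classical h) => v b.
by rewrite !truthE; bool_cases; case: (all b _); rewrite ?implybT.
Qed.

(** * Translation of the two-arrow calculus into the three-arrow one *)

Lemma derivable_SBoxLeft (s : seq formula) G D :
  (forall phi, phi \in s -> Box phi \in G) ->
  derivable D3seq (G `|` [fset x in s] |>[ArrS] D) ->
  derivable D3seq (G |>[ArrS] D).
Proof.
elim: s => [|phi s IHs] sG d.
  by move: d; apply: (derivable_weak D3_LK_S); sub_fset.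
apply: IHs => [psi psis|]; first by apply: sG; rewrite inE psis orbT.
(* [Box phi] already lies in [G], so it can be displayed as principal formula and is absorbed by the
   union. *)
rewrite -(mem_fset1U (sG _ (mem_head _ _))).
rewrite -fsetUA; apply: (derivable_step (D3_SBoxLeft (SBoxLeft_rule _ _ _))).
move=> p; rewrite inE => /eqP->.
by move: d; apply: (derivable_weak D3_LK_S); sub_fset.
Qed.

Lemma D2seq_D3seq s : derivable D2seq s -> derivable D3seq s.
Proof.
elim=> {s} ps s Rs _ dps.
case: Rs => Rs; first by apply: derivable_step dps; apply: D3_LK_GL.
- by apply: derivable_step dps; apply: D3_LK_D.
- by apply: derivable_step dps; apply: D3_GLBox.
case: Rs dps => G D /(_ _ (mem_head _ _)) d.
apply: (derivable_step (D3_StoD (StoD_rule G D))) => p.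
rewrite inE => /eqP->; apply: (derivable_SBoxLeft (s := enum_fset G)).
  by move=> phi phiG; apply: in_imfset.
have dS := derivable_step (D3_GLtoS (GLtoS_rule (G `|` boxes G) (boxes D))).
have {dS}dS : derivable D3seq (G `|` boxes G |>[ArrS] boxes D).
  by apply: dS => p'; rewrite inE => /eqP->.
by move: dS; apply: (derivable_weak D3_LK_S); sub_fset.
Qed.

(** * Completeness of the two-arrow calculus for the Hilbert systems *)

Lemma D2_LK_GL ps s : LK ArrGL ps s -> D2seq ps s.
Proof. by move=> ?; constructor 1. Qed.

Lemma D2_LK_D ps s : LK ArrD ps s -> D2seq ps s.
Proof. by move=> ?; constructor 2. Qed.

Lemma D2seq_GLBox G phi :
  derivable D2seq (G `|` boxes G `|` [fset Box phi] |>[ArrGL] [fset phi]) ->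
  derivable D2seq (boxes G |>[ArrGL] [fset Box phi]).
Proof.
move=> d; apply: (@derivable_step _ [:: _]).
  by constructor 3; constructor.
by move=> p; rewrite inE => /eqP->.
Qed.

Lemma D2seq_GLtoD G D :
  derivable D2seq (G `|` boxes G |>[ArrGL] boxes D) ->
  derivable D2seq (boxes G |>[ArrD] boxes D).
Proof.
move=> d; apply: (@derivable_step _ [:: _]).
  by constructor 4; constructor.
by move=> p; rewrite inE => /eqP->.
Qed.

(** K and Loeb's axiom each take one [GLBox] step from a propositionally valid premise;
    necessitation is [GLBox] with empty context. *)
Lemma GLH_D2seq phi : GLH phi -> derivable D2seq (fset0 |>[ArrGL] [fset phi]).
Proof.
elim=> {phi} [phi taut|phi psi|phi|phi psi _ d1 _ d2|phi _ d].
- apply: (derivable_valid D2_LK_GL) => v b.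
  by rewrite !truthE taut implybT.
- have d : derivable D2seq (boxes [fset Imp phi psi; phi] |>[ArrGL]
      [fset Box psi]).
    apply/D2seq_GLBox/(derivable_valid D2_LK_GL) => v b.
    by rewrite !truthE /=; bool_cases; rewrite implybT.
  apply: (derivable_consequence1 D2_LK_GL d) => v b.
  by rewrite !truthE /=; bool_cases.
- have d : derivable D2seq (boxes [fset Imp (Box phi) phi] |>[ArrGL]
      [fset Box phi]).
    apply/D2seq_GLBox/(derivable_valid D2_LK_GL) => v b.
    by rewrite !truthE /=; bool_cases; case: (b phi); rewrite ?implybT ?andbF.
  apply: (derivable_consequence1 D2_LK_GL d) => v b.
  by rewrite !truthE /=.
- exact: (derivable_MP D2_LK_GL d1 d2).
have {}d : derivable D2seq (boxes fset0 |>[ArrGL] [fset Box phi]).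
  apply: D2seq_GLBox; apply: (derivable_consequence1 D2_LK_GL d) => v b.
  by rewrite !truthE /=; bool_cases; rewrite implybT.
by apply: (derivable_consequence1 D2_LK_GL d) => v b; rewrite !truthE.
Qed.

(** [GLtoD] concludes only sequents of boxed formulas, so a GL theorem cannot be transferred in one
    step. Induction on its proof works because K, Loeb's axiom and necessitated formulas amount to
    such sequents, while modus ponens is handled by cut. *)
Lemma GLH_D2seq_D phi : GLH phi -> derivable D2seq (fset0 |>[ArrD] [fset phi]).
Proof.
elim=> {phi} [phi taut|phi psi|phi|phi psi _ d1 _ d2|phi gl_phi _].
- apply: (derivable_valid D2_LK_D) => v b.
  by rewrite !truthE taut implybT.
- have d : derivable D2seq (boxes [fset Imp phi psi; phi] |>[ArrD]
      boxes [fset psi]).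
    apply: D2seq_GLtoD.
    apply: (derivable_consequence1 D2_LK_GL (GLH_D2seq (GLH_K phi psi))) => v b.
    by rewrite !truthE /=; bool_cases; rewrite ?andbF ?implybT.
  apply: (derivable_consequence1 D2_LK_D d) => v b.
  by rewrite !truthE /=; bool_cases.
- have d : derivable D2seq (boxes [fset Imp (Box phi) phi] |>[ArrD]
      boxes [fset phi]).
    apply: D2seq_GLtoD.
    apply: (derivable_consequence1 D2_LK_GL (GLH_D2seq (GLH_Lob phi))) => v b.
    by rewrite !truthE /=; bool_cases; rewrite ?andbF ?implybT.
  apply: (derivable_consequence1 D2_LK_D d) => v b.
  by rewrite !truthE /=.
- exact: (derivable_MP D2_LK_D d1 d2).
(* The premise of [GLtoD] is a GL-sequent, so [phi] is necessitated in GL before the change of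
   arrow. *)
have {}d : derivable D2seq (boxes fset0 |>[ArrD] boxes [fset phi]).
  apply: D2seq_GLtoD.
  apply: (derivable_consequence1 D2_LK_GL (GLH_D2seq (GLH_Nec gl_phi))) => v b.
  by rewrite !truthE.
by apply: (derivable_consequence1 D2_LK_D d) => v b; rewrite !truthE.
Qed.

(** Each proper D axiom is one [GLtoD] step: the unboxed copy of the context, [Bot] or the
    disjunction, makes the premise propositionally valid. *)
Lemma DH_D2seq phi : DH phi -> derivable D2seq (fset0 |>[ArrD] [fset phi]).
Proof.
elim=> {phi} [phi /GLH_D2seq_D //||phi psi|phi psi _ d1 _ d2].
- have d : derivable D2seq (boxes [fset Bot] |>[ArrD] boxes fset0).
    apply/D2seq_GLtoD/(derivable_valid D2_LK_GL) => v b.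
    by rewrite !truthE.
  apply: (derivable_consequence1 D2_LK_D d) => v b.
  by rewrite !truthE /=.
- have d : derivable D2seq (boxes [fset Or (Box phi) (Box psi)] |>[ArrD]
      boxes [fset phi; psi]).
    apply/D2seq_GLtoD/(derivable_valid D2_LK_GL) => v b.
    by rewrite !truthE /=; bool_cases.
  apply: (derivable_consequence1 D2_LK_D d) => v b.
  by rewrite !truthE /=; bool_cases.
exact: (derivable_MP D2_LK_D d1 d2).
Qed.

Theorem proposition3p6 (Gamma Delta : {fset formula}) :
  (derivable D2seq (Gamma |>[ArrD] Delta) <->
     derivable D3seq (Gamma |>[ArrD] Delta)) /\
  (derivable D3seq (Gamma |>[ArrD] Delta) <->
     DH (Imp (bigAnd Gamma) (bigOr Delta))).
Proof.
have D3_DH : derivable D3seq (Gamma |>[ArrD] Delta) ->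
    DH (Imp (bigAnd Gamma) (bigOr Delta)) by exact: D3seq_sound.
have DH_D2 : DH (Imp (bigAnd Gamma) (bigOr Delta)) ->
    derivable D2seq (Gamma |>[ArrD] Delta).
  move/DH_D2seq => d; apply: (derivable_consequence1 D2_LK_D d) => v b.
  by rewrite truth_interp has_fset1.
have D2_D3 := @D2seq_D3seq (Gamma |>[ArrD] Delta).
by split; [split=> [/D2_D3|/D3_DH/DH_D2]|split=> [/D3_DH|/DH_D2/D2_D3]].
Qed.
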